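(* Suppose that all capacity requirements are equal, i.e. $A_k=A$ for all $1\le k\le K$. Then the dynamical system $y'(t)=V(y(t))$ on $\mathcal{P}(\mathcal{X})$ has a unique equilibrium point, i.e. there is exactly one $y\in\mathcal{P}(\mathcal{X})$ with $V(y)=0$.
   Context: Fix integers $K\ge1$, $C\ge1$, positive integers $A_1,\dots,A_K$ (capacity requirements) and rates $\lambda_k>0$, $\gamma_k>0$, $\mu_k\ge0$ for $1\le k\le K$. Let $f_k$ be the $k$th unit vector of $\mathbb{R}^K$, let $$\mathcal{X}=\{n=(n_k)\in\mathbb{N}^K: A_1n_1+\cdots+A_Kn_K\le C\}\quad(\mathbb{N}=\{0,1,2,\dots\}),$$ and let $\mathcal{P}(\mathcal{X})$ be the set of probability distributions $y=(y_n)_{n\in\mathcal{X}}$ on $\mathcal{X}$. Write $\langle\mathbb{I}_k,y\rangle=\sum_{m\in\mathcal{X}}m_ky_m$. The vector field $V(y)=(V_n(y),\,n\in\mathcal{X})$ is $$V_n(y)=\sum_{k=1}^{K}(\lambda_k+\gamma_k\langle\mathbb{I}_k,y\rangle)\left(y_{n-f_k}\mathbf{1}_{\{n_k\ge1\}}-y_n\mathbf{1}_{\{n+f_k\in\mathcal{X}\}}\right)+\sum_{k=1}^{K}(\gamma_k+\mu_k)\left((n_k+1)y_{n+f_k}\mathbf{1}_{\{n+f_k\in\mathcal{X}\}}-n_ky_n\right),$$ where terms multiplied by a zero indicator are $0$. *)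

(* Defs.v *)
From HB Require Import structures.
From mathcomp Require Import all_boot all_order all_algebra.
From mathcomp Require Import reals.

Set Implicit Arguments.
Unset Strict Implicit.
Unset Printing Implicit Defensive.

Import Order.TTheory GRing.Theory Num.Theory.
Local Open Scope ring_scope.

Definition feasible (K : nat) (A : 'I_K -> nat) (C : nat)
    (m : {ffun 'I_K -> nat}) : bool :=
  (\sum_(k < K) A k * m k <= C)%N.

(* The set X as a finite type. The coordinates are bounded by C so that the
   type is finite; when every A k is positive this loses no feasible vector
   (lemma [feasible_occ]). *)
Definition state (K : nat) (A : 'I_K -> nat) (C : nat) : Type :=
  {x : {ffun 'I_K -> 'I_C.+1} | feasible A C [ffun k => nat_of_ord (x k)]}.

HB.instance Definition _ (K : nat) (A : 'I_K -> nat) (C : nat) :=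
  Finite.on (state A C).

Definition occ (K : nat) (A : 'I_K -> nat) (C : nat) (x : state A C) :
  {ffun 'I_K -> nat} := [ffun k => nat_of_ord (sval x k)].

Lemma occ_inj (K : nat) (A : 'I_K -> nat) (C : nat) :
  injective (@occ K A C).
Proof.
move=> x y /ffunP exy; apply/val_inj/ffunP => k; apply/val_inj.
by have := exy k; rewrite !ffunE.
Qed.

Lemma feasible_occ (K : nat) (A : 'I_K -> nat) (C : nat)
    (hA : forall k, (0 < A k)%N) (m : {ffun 'I_K -> nat}) :
  feasible A C m <-> exists x : state A C, occ x = m.
Proof.
split=> [hm | [x <-]]; last exact: (valP x).
have mC k : (m k < C.+1)%N.
  rewrite ltnS; apply: leq_trans hm; rewrite (bigD1 k) //=.
  by apply: leq_trans (leq_addr _ _); apply: leq_pmull.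
pose x : {ffun 'I_K -> 'I_C.+1} := [ffun k => Ordinal (mC k)].
have xm : [ffun k => nat_of_ord (x k)] = m.
  by apply/ffunP => k; rewrite !ffunE.
have hx : feasible A C [ffun k => nat_of_ord (x k)] by rewrite xm.
by exists (exist _ x hx); rewrite /occ /= xm.
Qed.

Definition add_unit (K : nat) (k : 'I_K) (m : {ffun 'I_K -> nat}) :
  {ffun 'I_K -> nat} := [ffun j => (m j + (j == k))%N].

(* m - f_k, truncated at 0; only used when 1 <= m k. *)
Definition sub_unit (K : nat) (k : 'I_K) (m : {ffun 'I_K -> nat}) :
  {ffun 'I_K -> nat} := [ffun j => (m j - (j == k))%N].

(* y_m for an integer vector m, with the value 0 when m is not in X. *)
Definition coordinate (R : realType) (K : nat) (A : 'I_K -> nat) (C : nat)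
    (y : {ffun state A C -> R}) (m : {ffun 'I_K -> nat}) : R :=
  if [pick x : state A C | occ x == m] is Some x then y x else 0.

Lemma coordinate_occ (R : realType) (K : nat) (A : 'I_K -> nat) (C : nat)
    (y : {ffun state A C -> R}) (x : state A C) :
  coordinate y (occ x) = y x.
Proof.
rewrite /coordinate; case: pickP => [z /eqP /occ_inj -> // | /(_ x)].
by rewrite eqxx.
Qed.

Definition is_distribution (R : realType) (T : finType) (y : {ffun T -> R}) :
  Prop := (forall x, 0 <= y x) /\ \sum_x y x = 1.

Definition mean_occ (R : realType) (K : nat) (A : 'I_K -> nat) (C : nat)
    (k : 'I_K) (y : {ffun state A C -> R}) : R :=
  \sum_(x : state A C) (occ x k)%:R * y x.

Definition vector_field (R : realType) (K : nat) (A : 'I_K -> nat) (C : nat)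
    (lambda gamma mu : 'I_K -> R) (y : {ffun state A C -> R})
    (x : state A C) : R :=
  let n := occ x in
  \sum_(k < K) (lambda k + gamma k * mean_occ k y) *
     ((if (1 <= n k)%N then coordinate y (sub_unit k n) else 0)
      - (if feasible A C (add_unit k n) then y x else 0))
  + \sum_(k < K) (gamma k + mu k) *
     ((if feasible A C (add_unit k n)
       then (n k).+1%:R * coordinate y (add_unit k n) else 0)
      - (n k)%:R * y x).

Definition is_equilibrium (R : realType) (K : nat) (A : 'I_K -> nat) (C : nat)
    (lambda gamma mu : 'I_K -> R) (y : {ffun state A C -> R}) : Prop :=
  is_distribution y /\ forall x, vector_field lambda gamma mu y x = 0.

(* Main.v *)
Require Import Defs.
From HB Require Import structures.
From mathcomp Require Import all_boot all_order all_algebra.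
From mathcomp Require Import reals.
From mathcomp Require Import ring lra.

Set Implicit Arguments.
Unset Strict Implicit.
Unset Printing Implicit Defensive.

Import Order.TTheory GRing.Theory Num.Theory.
Local Open Scope ring_scope.

(** If the arrival rates [alpha k] of a loss network are held fixed, the linear
balance equations are those of a reversible Markov chain, whose only stationary
distribution is the product of Poisson laws of parameters
[rho k = alpha k / beta k] conditioned on the state space
([loss_generator_stationary]).  An equilibrium of the non-linear field is
therefore a product form whose parameters satisfy
[rho k * (gamma k + mu k) = lambda k + gamma k * mean_occ k], the mean being
taken under that same product form.

When all requirements equal [a], the state space is the set of vectors of total
at most [N = C %/ a].  The total of a product form then follows Erlang's law of
parameter [s = \sum_k rho k], and the mean of coordinate [k] is
[rho k * (1 - B s)], where [B] is Erlang's blocking probability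
([mean_occ_product_form]).  The equation on [rho k] becomes
[rho k = lambda k / (mu k + gamma k * B s)]: all the parameters are functions of
[s] alone, so that equilibria correspond to the solutions of the scalar equation
[s = \sum_k lambda k / (mu k + gamma k * B s)] ([equilibriumP]).  Since [B] is
nondecreasing, the right-hand side is nonincreasing while the left-hand side is
increasing, so there is at most one solution; the intermediate value theorem
gives one. *)

(** * Occupation vectors and Poisson weights *)

Definition total (K : nat) (m : {ffun 'I_K -> nat}) : nat := (\sum_k m k)%N.

Definition poisson_weight (R : realType) (K : nat) (rho : 'I_K -> R)
    (m : {ffun 'I_K -> nat}) : R :=
  \prod_k (rho k ^+ m k / (m k)`!%:R).

Section Vectors.
Variables (R : realType) (K : nat).
Implicit Types (m : {ffun 'I_K -> nat}) (k : 'I_K) (rho : 'I_K -> R).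

Lemma sub_unitK k m : (1 <= m k)%N -> add_unit k (sub_unit k m) = m.
Proof.
move=> mk; apply/ffunP => j; rewrite !ffunE.
by case: eqP => [->|_]; rewrite ?subnK ?subn0 ?addn0.
Qed.

Lemma add_unitK k m : sub_unit k (add_unit k m) = m.
Proof. by apply/ffunP => j; rewrite !ffunE addnK. Qed.

Lemma total_add_unit k m : total (add_unit k m) = (total m).+1.
Proof.
rewrite /total; under eq_bigr do rewrite ffunE.
rewrite big_split /= -addn1; congr (_ + _)%N.
by rewrite (bigD1 k) //= eqxx big1 ?addn0 // => j /negbTE ->.
Qed.

Lemma total_eq0 m : total m = 0 -> m = [ffun=> 0].
Proof.
move/eqP; rewrite sum_nat_eq0 => /forallP m0.
by apply/ffunP => k; rewrite ffunE; have /eqP := m0 k.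
Qed.

Lemma poisson_weight_gt0 rho m :
  (forall k, 0 < rho k) -> 0 < poisson_weight rho m.
Proof.
move=> rho_gt0; apply: prodr_gt0 => k _.
by rewrite divr_gt0 ?exprn_gt0 // ltr0n fact_gt0.
Qed.

(** Detailed balance: adding one unit of type [k] trades the departure factor
[m k + 1] for the load [rho k]. *)
Lemma poisson_weight_add_unit rho k m :
  (m k).+1%:R * poisson_weight rho (add_unit k m)
  = rho k * poisson_weight rho m.
Proof.
rewrite /poisson_weight (bigD1 k) //= [in RHS](bigD1 k) //= !mulrA.
congr (_ * _); last first.
  by apply: eq_bigr => j /negbTE jk; rewrite ffunE jk addn0.
rewrite ffunE eqxx addn1 exprS factS natrM.
have f0 : (m k)`!%:R != 0 :> R by rewrite pnatr_eq0 -lt0n fact_gt0.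
have s0 : (m k).+1%:R != 0 :> R by rewrite pnatr_eq0.
rewrite invfM; move: (m k).+1%:R (m k)`!%:R s0 f0 => s f s0 f0.
by field; apply/andP.
Qed.

End Vectors.

(** * Moving between states *)

(** The default value [x] keeps the map total: it is returned when [m] is
infeasible. *)
Definition to_state (K : nat) (A : 'I_K -> nat) (C : nat) (x : state A C)
    (m : {ffun 'I_K -> nat}) : state A C :=
  odflt x [pick z | occ z == m].

(** The balance field with the arrival rates frozen: [vector_field] is the case
where [alpha k] is the mean-field rate of its own argument. *)
Definition loss_generator (R : realType) (K : nat) (A : 'I_K -> nat) (C : nat)
    (alpha beta : 'I_K -> R) (y : {ffun state A C -> R}) (x : state A C) : R :=
  let n := occ x in
  \sum_(k < K) alpha k *
     ((if (1 <= n k)%N then coordinate y (sub_unit k n) else 0)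
      - (if feasible A C (add_unit k n) then y x else 0))
  + \sum_(k < K) beta k *
     ((if feasible A C (add_unit k n)
       then (n k).+1%:R * coordinate y (add_unit k n) else 0)
      - (n k)%:R * y x).

Definition product_form (R : realType) (K : nat) (A : 'I_K -> nat) (C : nat)
    (rho : 'I_K -> R) : {ffun state A C -> R} :=
  [ffun x => poisson_weight rho (occ x)
             / \sum_(z : state A C) poisson_weight rho (occ z)].

Section States.
Variables (R : realType) (K : nat) (A : 'I_K -> nat) (C : nat).
Hypothesis hA : forall k, (1 <= A k)%N.
Implicit Types (m : {ffun 'I_K -> nat}) (k : 'I_K) (x : state A C).
Implicit Types (y h : {ffun state A C -> R}).

Lemma feasible_sub_unit k x : feasible A C (sub_unit k (occ x)).
Proof.
apply: leq_trans (valP x); apply: leq_sum => j _.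
by rewrite leq_mul2l !ffunE leq_subr orbT.
Qed.

Lemma feasible0 : feasible A C [ffun=> 0]%N.
Proof. by rewrite /feasible big1 // => k _; rewrite ffunE muln0. Qed.

Lemma occ_to_state x m : feasible A C m -> occ (to_state x m) = m.
Proof.
move=> /(feasible_occ C hA)[z zm]; rewrite /to_state.
by case: pickP => [u /eqP //|/(_ z)]; rewrite zm eqxx.
Qed.

Lemma to_state_occ x z : to_state x (occ z) = z.
Proof. by apply: occ_inj; rewrite occ_to_state //; exact: (valP z). Qed.

Lemma coordinate_to_state y x m :
  feasible A C m -> coordinate y m = y (to_state x m).
Proof. by move=> fm; rewrite -coordinate_occ occ_to_state. Qed.

(** Adding one unit of type [k] is a bijection from the states that can still
receive it onto those that contain one, with inverse its removal. *)
Lemma sum_shift (k : 'I_K) (G : {ffun 'I_K -> nat} -> R) :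
  \sum_(x : state A C | (1 <= occ x k)%N) G (occ x)
  = \sum_(x : state A C | feasible A C (add_unit k (occ x)))
      G (add_unit k (occ x)).
Proof.
pose up (z : state A C) := to_state z (add_unit k (occ z)).
pose down (z : state A C) := to_state z (sub_unit k (occ z)).
have occ_down z : occ (down z) = sub_unit k (occ z).
  by rewrite occ_to_state ?feasible_sub_unit.
have up_dom z : (0 < occ (up z) k)%N && (down (up z) == z)
    = feasible A C (add_unit k (occ z)).
  have [fz|nfz] := boolP (feasible A C (add_unit k (occ z))).
    rewrite /down occ_to_state // add_unitK to_state_occ eqxx andbT.
    by rewrite ffunE eqxx addn1.
  (* [up z] falls back on [z] itself, which is not one step above [z] *)
  have -> : up z = z.
    rewrite /up /to_state; case: pickP => //= u /eqP eu.
    by case/negP: nfz; rewrite -eu; exact: (valP u).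
  apply/negP => /andP[nz /eqP /(congr1 (@occ _ _ _))].
  rewrite occ_down => /ffunP/(_ k).
  by rewrite [LHS]ffunE eqxx subn1; case: (occ z k) nz => //= n _ /n_Sn.
rewrite (reindex_onto up down) /=; last first.
  move=> z nz; rewrite /up occ_down sub_unitK //; exact: to_state_occ.
rewrite (eq_bigl _ _ up_dom); apply: eq_bigr => z fz.
by rewrite occ_to_state.
Qed.

(** * The stationary distribution for fixed arrival rates *)

Section Generator.
Variables (alpha beta rho : 'I_K -> R).
Hypothesis rho_def : forall k, rho k * beta k = alpha k.

(** The generator read on densities with respect to the Poisson weights.  By
detailed balance it becomes a positive combination of the differences of [h]
between a state and its neighbours, as for a weighted graph Laplacian. *)
Definition density_generator h x : R :=
  let n := occ x in
  \sum_(k | (1 <= n k)%N) alpha k * poisson_weight rho (sub_unit k n)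
       * (coordinate h (sub_unit k n) - h x)
  + \sum_(k | feasible A C (add_unit k n)) alpha k * poisson_weight rho n
       * (coordinate h (add_unit k n) - h x).

Lemma loss_generator_density h x :
  loss_generator alpha beta [ffun z => poisson_weight rho (occ z) * h z] x
  = density_generator h x.
Proof.
rewrite /loss_generator /density_generator; set y := [ffun z => _].
have yE m : coordinate y m = poisson_weight rho m * coordinate h m.
  rewrite /coordinate; case: pickP => [z /eqP <-|_]; last by rewrite mulr0.
  by rewrite ffunE.
have yx : y x = poisson_weight rho (occ x) * h x by rewrite ffunE.
rewrite {}yx; move: (occ x) => n.
rewrite -big_split /= [X in _ = X + _]big_mkcond [X in _ = _ + X]big_mkcond /=.
rewrite -big_split /=; apply: eq_bigr => k _.
rewrite !yE -rho_def.
have up := poisson_weight_add_unit rho k n.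
have down : (1 <= n k)%N -> (n k)%:R * poisson_weight rho n
    = rho k * poisson_weight rho (sub_unit k n).
  move=> nk; have := poisson_weight_add_unit rho k (sub_unit k n).
  by rewrite sub_unitK // ffunE eqxx subn1 prednK.
rewrite (mulrA (n k).+1%:R) up (mulrA (n k)%:R).
have [nk|] := ltnP 0 (n k).
  by rewrite down //; case: ifP => _; ring.
by rewrite leqn0 => /eqP ->; case: ifP => _; ring.
Qed.

Hypothesis alpha_gt0 : forall k, 0 < alpha k.
Hypothesis rho_gt0 : forall k, 0 < rho k.

(** Maximum principle: at a maximizer every difference in the generator is
nonpositive, so all of them vanish and each neighbour is a maximizer too.
Removing units one by one carries the maximum down to the empty state. *)
Lemma harmonic_le_empty h (z0 : state A C) : occ z0 = [ffun=> 0]%N ->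
  (forall x, density_generator h x = 0) -> forall x, h x <= h z0.
Proof.
move=> z00 harm x; pose M := [arg max_(z > x) h z]%O.
have Mmax z : h z <= h M by rewrite /M; case: arg_maxP => // i _; apply.
suff down s z : total (occ z) = s -> h z = h M -> h z0 = h M.
  by rewrite (down _ M erefl erefl).
elim: s z => [|s IHs] z zs zM.
  by rewrite -zM; congr (h _); apply: occ_inj; rewrite z00 (total_eq0 zs).
have [k nk] : exists k, (1 <= occ z k)%N.
  apply/existsP; apply: contraPT zs; rewrite negb_exists => /forallP n0.
  by rewrite /total big1 // => k _; have := n0 k; rewrite -leqNgt leqn0 => /eqP.
pose u := to_state z (sub_unit k (occ z)).
have uE : occ u = sub_unit k (occ z) by rewrite occ_to_state ?feasible_sub_unit.
have coord_le m : feasible A C m -> coordinate h m - h z <= 0.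
  by move=> fm; rewrite (coordinate_to_state _ z) // zM subr_le0.
apply: (IHs u).
  by move: zs; rewrite uE -{1}(sub_unitK nk) total_add_unit => -[].
have := harm z; rewrite /density_generator (bigD1 k) //= => sum0.
have low : \sum_(i | (0 < occ z i)%N && (i != k))
    alpha i * poisson_weight rho (sub_unit i (occ z)) *
    (coordinate h (sub_unit i (occ z)) - h z) <= 0.
  apply: sumr_le0 => i _; rewrite pmulr_rle0 ?coord_le ?feasible_sub_unit //.
  by rewrite mulr_gt0 // poisson_weight_gt0.
have high : \sum_(i | feasible A C (add_unit i (occ z)))
    alpha i * poisson_weight rho (occ z) *
    (coordinate h (add_unit i (occ z)) - h z) <= 0.
  apply: sumr_le0 => i fi; rewrite pmulr_rle0 ?coord_le //.
  by rewrite mulr_gt0 // poisson_weight_gt0.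
have : 0 <= alpha k * poisson_weight rho (sub_unit k (occ z)) *
    (coordinate h (sub_unit k (occ z)) - h z) by lra.
rewrite pmulr_rge0; last by rewrite mulr_gt0 // poisson_weight_gt0.
rewrite -uE coordinate_occ subr_ge0 zM => Mu.
by apply/eqP; rewrite eq_le Mmax Mu.
Qed.

(** The maximum principle applied to [h] and to [- h] bounds every value on both
sides by the value at the empty state. *)
Lemma harmonic_const h x z :
  (forall x, density_generator h x = 0) -> h x = h z.
Proof.
move=> harm; pose z0 := to_state x [ffun=> 0]%N.
have z00 : occ z0 = [ffun=> 0]%N by rewrite occ_to_state ?feasible0.
suff h0 u : h u = h z0 by rewrite !h0.
apply/eqP; rewrite eq_le (harmonic_le_empty z00 harm) /=.
pose g : {ffun state A C -> R} := [ffun v => - h v].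
have gE m : coordinate g m = - coordinate h m.
  by rewrite /coordinate; case: pickP => [v _|_]; rewrite ?ffunE ?oppr0.
have gharm v : density_generator g v = 0.
  rewrite -[RHS]oppr0 -[in RHS](harm v) /density_generator opprD -!sumrN.
  by congr (_ + _); apply: eq_bigr => k _; rewrite gE ffunE; ring.
by have := harmonic_le_empty z00 gharm u; rewrite !ffunE lerN2.
Qed.

(** A stationary [y] has constant density with respect to the Poisson weights,
and the total mass fixes the constant. *)
Lemma loss_generator_stationary y :
  is_distribution y /\ (forall x, loss_generator alpha beta y x = 0) <->
  y = product_form A C rho.
Proof.
rewrite /product_form.
have w0 x : poisson_weight rho (occ x) != 0.
  by rewrite gt_eqF // poisson_weight_gt0.
set Z := \sum_z _.
have [x0 _] : exists x : state A C, occ x = [ffun=> 0]%N.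
  exact/(feasible_occ C hA)/feasible0.
have Z_gt0 : 0 < Z.
  rewrite /Z (bigD1 x0) //= ltr_pwDl ?poisson_weight_gt0 //.
  by apply: sumr_ge0 => z _; rewrite ltW ?poisson_weight_gt0.
split=> [[[_ y1] stat] | ->].
  pose h : {ffun state A C -> R} :=
    [ffun x => y x / poisson_weight rho (occ x)].
  have yh z : y z = poisson_weight rho (occ z) * h z.
    by rewrite ffunE mulrC divfK.
  have yE : y = [ffun z => poisson_weight rho (occ z) * h z].
    by apply/ffunP => z; rewrite [RHS]ffunE.
  have hc x : h x = h x0.
    by apply: harmonic_const => z; rewrite -loss_generator_density -yE.
  have hx0 : h x0 = Z^-1.
    move: y1; under eq_bigr do rewrite yh hc.
    by rewrite -mulr_suml => /(canRL (mulKf (lt0r_neq0 Z_gt0))); rewrite mulr1.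
  by apply/ffunP => x; rewrite ffunE yh hc hx0.
split; first split => [x|].
- by rewrite ffunE divr_ge0 ?ltW ?poisson_weight_gt0.
- by under eq_bigr do rewrite ffunE; rewrite -mulr_suml divff ?gt_eqF.
move=> x; pose h : {ffun state A C -> R} := [ffun=> Z^-1].
have -> : [ffun x => poisson_weight rho (occ x) / Z]
    = [ffun z => poisson_weight rho (occ z) * h z].
  by apply/ffunP => z; rewrite !ffunE.
rewrite loss_generator_density /density_generator.
rewrite !big1 ?addr0 // => k hk;
rewrite (coordinate_to_state _ x) ?feasible_sub_unit //;
by rewrite !ffunE subrr mulr0.
Qed.

End Generator.
End States.

(** * Erlang's blocking probability and the total load equation *)

Section Erlang.
Variables (R : realType) (N : nat).
Implicit Types s t : R.

Definition erlang_sum s : R := \sum_(j < N.+1) s ^+ j / j`!%:R.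

Definition erlang_blocking s : R := (s ^+ N / N`!%:R) / erlang_sum s.

Lemma erlang_sum_gt0 s : 0 < s -> 0 < erlang_sum s.
Proof.
move=> s0; rewrite /erlang_sum (bigD1 ord0) //= ltr_pwDl //.
  by rewrite expr0 fact0 divr1.
by apply: sumr_ge0 => j _; rewrite divr_ge0 ?exprn_ge0 ?ler0n ?(ltW s0).
Qed.

Lemma erlang_blocking_gt0 s : 0 < s -> 0 < erlang_blocking s.
Proof.
move=> s0; rewrite divr_gt0 ?erlang_sum_gt0 // divr_gt0 ?exprn_gt0 //.
by rewrite ltr0n fact_gt0.
Qed.

Lemma erlang_blocking_le1 s : 0 < s -> erlang_blocking s <= 1.
Proof.
move=> s0; rewrite ler_pdivrMr ?erlang_sum_gt0 // mul1r.
rewrite /erlang_sum big_ord_recr /= lerDr.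
by apply: sumr_ge0 => j _; rewrite divr_ge0 ?exprn_ge0 ?ler0n ?(ltW s0).
Qed.

(** After cross-multiplication, the two sides compare term by term:
[s ^+ N * t ^+ j <= t ^+ N * s ^+ j] for [j <= N]. *)
Lemma erlang_blocking_le s t :
  0 < s -> s <= t -> erlang_blocking s <= erlang_blocking t.
Proof.
move=> s0 st; have t0 := lt_le_trans s0 st.
rewrite ler_pdivrMr ?erlang_sum_gt0 // mulrAC ler_pdivlMr ?erlang_sum_gt0 //.
rewrite /erlang_sum !mulr_sumr; apply: ler_sum => j _.
have jN : (j <= N)%N by rewrite -ltnS.
have key d : s ^+ (d + j) * t ^+ j <= t ^+ (d + j) * s ^+ j.
  rewrite !exprD -!mulrA (mulrC (s ^+ j)) ler_wpM2r //.
    by rewrite mulr_ge0 ?exprn_ge0 ?ltW.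
  by apply: lerXn2r; rewrite ?nnegrE ?(ltW s0) ?(ltW t0).
have {key} := key (N - j)%N; rewrite subnK // => key.
rewrite mulrACA [leRHS]mulrACA ler_wpM2r //.
by rewrite mulr_ge0 // invr_ge0.
Qed.

Variables (K : nat) (lambda gamma mu : 'I_K -> R).
Hypothesis hK : (1 <= K)%N.
Hypothesis hlambda : forall k, 0 < lambda k.
Hypothesis hgamma : forall k, 0 < gamma k.
Hypothesis hmu : forall k, 0 <= mu k.

(** The load of type [k] that an equilibrium must have once its total load [s],
and with it the blocking probability, is known. *)
Definition offered_load s (k : 'I_K) : R :=
  lambda k / (mu k + gamma k * erlang_blocking s).

Lemma unblocked_rate_gt0 s k :
  0 < s -> 0 < mu k + gamma k * erlang_blocking s.
Proof. by move=> s0; rewrite ltr_wpDl // mulr_gt0 ?erlang_blocking_gt0. Qed.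

Lemma offered_load_gt0 s k : 0 < s -> 0 < offered_load s k.
Proof.
by move=> s0; rewrite divr_gt0 // unblocked_rate_gt0.
Qed.

Lemma offered_load_anti s t k :
  0 < s -> s <= t -> offered_load t k <= offered_load s k.
Proof.
move=> s0 st; have t0 := lt_le_trans s0 st.
rewrite ler_pM2l // lef_pV2 ?posrE ?unblocked_rate_gt0 //.
by rewrite lerD2l ler_pM2l // erlang_blocking_le.
Qed.

(** For [s <= t] the right-hand sides are in the opposite order, because every
[offered_load] is nonincreasing in the total load; hence [t <= s]. *)
Lemma total_load_unique s t :
  0 < s -> 0 < t -> s = \sum_k offered_load s k ->
  t = \sum_k offered_load t k -> s = t.
Proof.
wlog st : s t / s <= t => [hw s0 t0 es et|s0 t0 es et].
  by have [/hw|/ltW/hw] := leP s t; move=> h; [|symmetry]; apply: h.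
apply/eqP; rewrite eq_le st /= et es; apply: ler_sum => k _.
exact: offered_load_anti.
Qed.

(** Clearing denominators turns the equation into the vanishing of a polynomial
[Q] which, on positive reals, has the sign of [s - \sum_k offered_load s k].
Bounding the blocking probability by [1] gives a point [lo] where this is
nonpositive; by monotonicity it is nonnegative at
[hi = \sum_k offered_load lo k]. *)
Lemma total_load_exists : exists2 s, 0 < s & s = \sum_k offered_load s k.
Proof.
have [p pE] : exists p : {poly R}, forall s, p.[s] = s ^+ N / N`!%:R.
  by exists ((N`!%:R)^-1 *: 'X^N) => s; rewrite !hornerE mulrC.
have [P PE] : exists P : {poly R}, forall s, P.[s] = erlang_sum s.
  exists (\sum_(j < N.+1) (j`!%:R)^-1 *: 'X^j) => s.
  by rewrite horner_sum; apply: eq_bigr => j _; rewrite !hornerE mulrC.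
pose D k := mu k *: P + gamma k *: p.
pose Q := 'X * \prod_k D k - \sum_k lambda k *: (P * \prod_(j | j != k) D j).
have DE s k : 0 < s ->
    (D k).[s] = (mu k + gamma k * erlang_blocking s) * erlang_sum s.
  move=> s0; rewrite /D hornerD !hornerZ pE PE mulrDl /erlang_blocking.
  congr (_ + _).
  by rewrite -mulrA divfK // gt_eqF ?erlang_sum_gt0.
have D_gt0 s k : 0 < s -> 0 < (D k).[s].
  move=> s0; rewrite DE // mulr_gt0 ?erlang_sum_gt0 //.
  by rewrite unblocked_rate_gt0.
have QE s : 0 < s ->
    Q.[s] = \prod_k (D k).[s] * (s - \sum_k offered_load s k).
  move=> s0; rewrite /Q hornerD hornerN hornerM hornerX horner_prod.
  rewrite horner_sum mulrBr mulrC.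
  congr (_ - _); rewrite mulr_sumr; apply: eq_bigr => k _.
  rewrite hornerZ hornerM horner_prod PE [in RHS](bigD1 k) //= DE //.
  rewrite /offered_load.
  have d0 : mu k + gamma k * erlang_blocking s != 0.
    by rewrite gt_eqF ?unblocked_rate_gt0.
  by field.
have prod_gt0 s : 0 < s -> 0 < \prod_k (D k).[s].
  by move=> s0; apply: prodr_gt0 => k _; apply: D_gt0.
have sum_gt0 (f : 'I_K -> R) : (forall k, 0 < f k) -> 0 < \sum_k f k.
  move=> f0; rewrite (bigD1 (Ordinal hK)) //= ltr_pwDl //.
  by apply: sumr_ge0 => k _; rewrite ltW.
pose lo := \sum_k lambda k / (mu k + gamma k).
have lo_gt0 : 0 < lo by apply: sum_gt0 => k; rewrite divr_gt0 // ltr_wpDl.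
have lo_le s : 0 < s -> lo <= \sum_k offered_load s k.
  move=> s0; apply: ler_sum => k _; rewrite ler_pM2l //.
  rewrite lef_pV2 ?posrE ?unblocked_rate_gt0 ?ltr_wpDl //.
  by rewrite lerD2l ler_piMr ?erlang_blocking_le1 // ltW.
pose hi := \sum_k offered_load lo k.
have lo_hi : lo <= hi by apply: lo_le.
have hi_gt0 := lt_le_trans lo_gt0 lo_hi.
have [|s /andP[los _] /rootP Qs] := @poly_ivt _ Q lo hi lo_hi.
  rewrite !QE // pmulr_rle0 ?pmulr_rge0 ?prod_gt0 // subr_le0 subr_ge0 lo_hi /=.
  by apply: ler_sum => k _; rewrite offered_load_anti.
have s0 := lt_le_trans lo_gt0 los; exists s => //; apply/eqP.
move: Qs; rewrite QE // => /eqP.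
by rewrite mulf_eq0 (gt_eqF (prod_gt0 s s0)) subr_eq0.
Qed.

End Erlang.

(** * Product forms when all requirements are equal *)

Section EqualRequirements.
Variables (R : realType) (K : nat) (A : 'I_K -> nat) (C a : nat).
Hypothesis hA : forall k, (1 <= A k)%N.
Hypothesis a_gt0 : (0 < a)%N.
Hypothesis hAa : forall k, A k = a.
Variable rho : 'I_K -> R.
Implicit Types (m : {ffun 'I_K -> nat}) (k : 'I_K).

Local Notation N := (C %/ a)%N.
Local Notation S := (\sum_k rho k).
Local Notation w := (poisson_weight rho).

Lemma feasible_total m : feasible A C m = (total m <= N)%N.
Proof.
rewrite /feasible leq_divRL // mulnC big_distrr /=.
by congr (_ <= _)%N; apply: eq_bigr => k _; rewrite hAa.
Qed.

(** Detailed balance combined with the shift of states.  The test function [F]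
of the total serves twice: a constant gives the means, and the indicator of a
level gives the recursion between consecutive levels. *)
Lemma sum_occ_weight k (F : nat -> R) :
  \sum_(x : state A C) (occ x k)%:R * w (occ x) * F (total (occ x))
  = rho k * \sum_(x : state A C | (total (occ x) < N)%N)
      w (occ x) * F (total (occ x)).+1.
Proof.
rewrite (bigID (fun x : state A C => (1 <= occ x k)%N)) /= addrC big1 ?add0r.
  rewrite (sum_shift C hA k (fun m => (m k)%:R * w m * F (total m))) mulr_sumr.
  apply: eq_big => [x|x _]; first by rewrite feasible_total total_add_unit.
  rewrite total_add_unit ffunE eqxx addn1 poisson_weight_add_unit.
  by rewrite mulrA.
by move=> x; rewrite -leqNgt leqn0 => /eqP ->; rewrite !mul0r.
Qed.

(** This is the multinomial formula.  It is obtained by induction: summing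
[sum_occ_weight] over [k] with [F] the indicator of level [j + 1] counts the
total occupation, that is [j + 1], on one side and the total load on the other.
*)
Lemma sum_level_weight j : (j <= N)%N ->
  \sum_(x : state A C | total (occ x) == j) w (occ x) = S ^+ j / j`!%:R.
Proof.
elim: j => [_|j IHj jN].
  have [x0 x00] : exists x : state A C, occ x = [ffun=> 0]%N.
    exact/(feasible_occ C hA)/feasible0.
  rewrite (big_pred1 x0) => [|x].
    rewrite x00 /poisson_weight big1 ?expr0 ?fact0 ?divr1 // => k _.
    by rewrite ffunE expr0 fact0 divr1.
  apply/eqP/eqP => [/total_eq0 x0E|->]; first by apply: occ_inj; rewrite x00.
  by rewrite x00 /total big1 // => k _; rewrite ffunE.
have step : j.+1%:R * \sum_(x : state A C | total (occ x) == j.+1) w (occ x)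
    = S * \sum_(x : state A C | total (occ x) == j) w (occ x).
  pose F i : R := (i == j.+1)%:R.
  transitivity (\sum_k \sum_(x : state A C)
      (occ x k)%:R * w (occ x) * F (total (occ x))).
    rewrite exchange_big mulr_sumr big_mkcond /=; apply: eq_bigr => x _.
    rewrite -!mulr_suml -natr_sum /F -/(total _).
    by case: eqP => [->|]; rewrite ?mulr1 ?mulr0.
  rewrite mulr_suml; apply: eq_bigr => k _; rewrite sum_occ_weight.
  congr (_ * _); rewrite big_mkcond [RHS]big_mkcond; apply: eq_bigr => x _.
  rewrite /F eqSS; case: eqP => [->|_]; first by rewrite jN mulr1.
  by rewrite mulr0 if_same.
have j0 : j.+1%:R != 0 :> R by rewrite pnatr_eq0.
rewrite -[LHS](mulKf j0) step (IHj (ltnW jN)) exprS factS natrM invfM.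
by rewrite mulrCA [RHS]mulrACA -mulrA.
Qed.

Lemma sum_weight : \sum_(x : state A C) w (occ x) = erlang_sum N S.
Proof.
pose level (x : state A C) : 'I_N.+1 := inord (total (occ x)).
have levelE x : level x = total (occ x) :> nat.
  by rewrite inordK // ltnS -feasible_total; exact: (valP x).
rewrite (partition_big level xpredT) //=; apply: eq_bigr => j _.
have jN : (j <= N)%N by rewrite -ltnS.
rewrite -(sum_level_weight jN); apply: eq_bigl => x.
by rewrite -levelE.
Qed.

(** The shift identity leaves [rho k] times the probability that the network is
not full. *)
Lemma mean_occ_product_form k : 0 < S ->
  mean_occ k (product_form A C rho) = rho k * (1 - erlang_blocking N S).
Proof.
move=> S0; rewrite /mean_occ /product_form; set Z := erlang_sum N S.
have Z0 : Z != 0 by rewrite gt_eqF ?erlang_sum_gt0.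
transitivity ((\sum_(x : state A C) (occ x k)%:R * w (occ x) * 1) / Z).
  rewrite mulr_suml; apply: eq_bigr => x _.
  by rewrite mulr1 -mulrA; congr (_ * _); rewrite [LHS]ffunE sum_weight.
rewrite (sum_occ_weight k (fun=> 1)) -mulrA; congr (_ * _).
have -> : erlang_blocking N S = (S ^+ N / N`!%:R) / Z by [].
rewrite -[X in _ = X - _](divff Z0) -mulrBl -(sum_level_weight (leqnn N)).
rewrite /Z -sum_weight.
congr (_ / _); rewrite [X in _ = X - _](bigID (fun x => (total (occ x) < N)%N)).
rewrite /= [X in _ = _ + X - _](eq_bigl (fun x => total (occ x) == N)).
  by rewrite addrK; apply: eq_bigr => x _; rewrite mulr1.
by move=> x; rewrite -leqNgt eqn_leq -feasible_total (valP x : feasible _ _ _).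
Qed.

End EqualRequirements.

(** * Equilibria and solutions of the total load equation *)

Section Equilibrium.
Variables (R : realType) (K C : nat) (A : 'I_K -> nat).
Variables (lambda gamma mu : 'I_K -> R) (a : nat).
Hypothesis hK : (1 <= K)%N.
Hypothesis hA : forall k, (1 <= A k)%N.
Hypothesis hlambda : forall k, 0 < lambda k.
Hypothesis hgamma : forall k, 0 < gamma k.
Hypothesis hmu : forall k, 0 <= mu k.
Hypothesis hAa : forall k, A k = a.

Local Notation N := (C %/ a)%N.

(** Substituting the mean [rho k * (1 - B s)] in
[rho k * (gamma k + mu k) = lambda k + gamma k * mean_occ k] cancels
[gamma k * rho k] on both sides and leaves
[rho k * (mu k + gamma k * B s) = lambda k]. *)
Lemma equilibriumP (y : {ffun state A C -> R}) :
  is_equilibrium lambda gamma mu y <->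
  exists s, [/\ 0 < s, s = \sum_k offered_load N lambda gamma mu s k
              & y = product_form A C (offered_load N lambda gamma mu s)].
Proof.
have a_gt0 : (0 < a)%N by rewrite -(hAa (Ordinal hK)).
have beta_gt0 k : 0 < gamma k + mu k by rewrite ltr_pwDl.
split=> [eqy | [s [s0 es ->]]].
  have [[y_ge0 _] _] := eqy.
  pose alpha k := lambda k + gamma k * mean_occ k y.
  have alpha_gt0 k : 0 < alpha k.
    rewrite ltr_pwDl // mulr_ge0 ?(ltW (hgamma k)) //; apply: sumr_ge0 => x _.
    by rewrite mulr_ge0.
  pose rho k := alpha k / (gamma k + mu k).
  have rho_gt0 k : 0 < rho k by rewrite divr_gt0.
  have rho_def k : rho k * (gamma k + mu k) = alpha k.
    by rewrite divfK ?gt_eqF.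
  have /(loss_generator_stationary hA rho_def alpha_gt0 rho_gt0) yE :
    is_distribution y /\
    forall x, loss_generator alpha (fun k => gamma k + mu k) y x = 0 by [].
  have s0 : 0 < \sum_k rho k.
    rewrite (bigD1 (Ordinal hK)) //= ltr_pwDl // sumr_ge0 // => k _.
    exact: ltW.
  set s := \sum_k rho k in s0.
  have rhoE k : rho k = offered_load N lambda gamma mu s k.
    have d0 := unblocked_rate_gt0 N hgamma hmu k s0.
    rewrite /offered_load; apply: (canRL (mulfK (lt0r_neq0 d0))).
    have mean_k : mean_occ k y = rho k * (1 - erlang_blocking N s).
      by rewrite yE (mean_occ_product_form C hA a_gt0 hAa).
    have := rho_def k; rewrite /alpha mean_k => fixpoint.
    apply: (addIr (gamma k * (rho k * (1 - erlang_blocking N s)))).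
    by rewrite -fixpoint; ring.
  exists s; split=> //; first exact: eq_bigr.
  rewrite {1}yE; apply/ffunP => x; rewrite /product_form !ffunE.
  have wE m : poisson_weight rho m
      = poisson_weight (offered_load N lambda gamma mu s) m.
    by apply: eq_bigr => k _; rewrite rhoE.
  by rewrite wE; congr (_ / _); apply: eq_bigr => z _; rewrite wE.
set rho := offered_load N lambda gamma mu s; set p := product_form A C rho.
have rho_gt0 k : 0 < rho k by apply: offered_load_gt0.
pose alpha k := lambda k + gamma k * mean_occ k p.
have rho_def k : rho k * (gamma k + mu k) = alpha k.
  have d0 := unblocked_rate_gt0 N hgamma hmu k s0.
  have mean_k : mean_occ k p = rho k * (1 - erlang_blocking N s).
    by rewrite /p (mean_occ_product_form C hA a_gt0 hAa) -es.
  have loadE : rho k * (mu k + gamma k * erlang_blocking N s) = lambda k.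
    by rewrite divfK ?gt_eqF.
  rewrite /alpha mean_k -loadE; ring.
have alpha_gt0 k : 0 < alpha k by rewrite -rho_def mulr_gt0.
exact/(loss_generator_stationary hA rho_def alpha_gt0 rho_gt0).
Qed.

End Equilibrium.

Theorem proposition2 (R : realType) (K C : nat) (A : 'I_K -> nat)
    (lambda gamma mu : 'I_K -> R)
    (hK : (1 <= K)%N) (hC : (1 <= C)%N)
    (hA : forall k, (1 <= A k)%N)
    (hlambda : forall k, 0 < lambda k)
    (hgamma : forall k, 0 < gamma k)
    (hmu : forall k, 0 <= mu k)
    (a : nat) (hAa : forall k, A k = a) :
  exists! y : {ffun state A C -> R}, is_equilibrium lambda gamma mu y.
Proof.
have equilP (y : {ffun state A C -> R}) :=
  equilibriumP hK hA hlambda hgamma hmu hAa y.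
have [s s0 es] := total_load_exists (C %/ a) hK hlambda hgamma hmu.
exists (product_form A C (offered_load (C %/ a) lambda gamma mu s)).
split=> [|y /equilP[t [t0 et ->]]]; first by apply/equilP; exists s.
by rewrite (total_load_unique hlambda hgamma hmu s0 t0 es et).
Qed.
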